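(* Let $\{v_1,\dots,v_n\}\subset\mathbb{R}^n$ be an orthonormal set of vectors, let $1\le k\le n$, $\lambda_1\ge\cdots\ge\lambda_k>0$ and $\theta>0$, define $\alpha_i=1-\frac{\theta}{\lambda_i}$ for $i=1,\dots,k$, and $H_k=\prod_{i=1}^k(I_n-\alpha_iv_iv_i^T)$. Let $y_C\in\operatorname{span}\{v_{k+1},\dots,v_n\}$ be nonzero (so that $H_ky_C=y_C$ exactly), and let $\operatorname{fl}(H_ky_C)$ be the vector computed in floating-point arithmetic by applying the rank-one factors successively for $i=1,\dots,k$ (rounding model in the context). Then, to first order in the unit roundoff $u$, $$\frac{\|y_C-\operatorname{fl}(H_ky_C)\|}{\|y_C\|}\le(\gamma_n+ku)\sqrt{\sum_{i=1}^k\alpha_i^2}+ku+\mathcal O(u^2).$$ Moreover, the first-order upper bound $\theta\mapsto(\gamma_n+ku)\sqrt{\sum_{i=1}^k(1-\theta/\lambda_i)^2}+ku$ is uniquely minimized at $$\theta_{\mathrm{WAM}}=\frac{\sum_{i=1}^k 1/\lambda_i}{\sum_{i=1}^k1/\lambda_i^2},$$ which is the weighted arithmetic mean of $\lambda_1,\dots,\lambda_k$ with weights $w_i=\frac{1}{\lambda_i^2}$.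
   Context: Notation: $\|\cdot\|$ is the Euclidean norm; $\circ$ is the Hadamard (elementwise) product; $\mathbf 1=(1,\dots,1)^T\in\mathbb{R}^n$; $u>0$ is the unit roundoff with $nu<1$, and $\gamma_n=\frac{nu}{1-nu}$. The scalar $\theta$ is the cluster point of the spectral limited-memory preconditioner $H_k$. Floating-point model. For $a,b\in\mathbb{R}^n$, $\operatorname{fl}(a^Tb)=a^Tb+\delta$ with $|\delta|\le\gamma_n\|a\|\|b\|$. The computed vector $\operatorname{fl}(H_ky_C)=\widehat y^{(k)}$ is defined by $\widehat y^{(0)}=y_C$ and, for $i=1,\dots,k$, $$\widehat y^{(i)}=\Big[\widehat y^{(i-1)}-\alpha_i\,\operatorname{fl}\big(v_i^T\widehat y^{(i-1)}\big)\,v_i\Big]\circ(\mathbf 1+\mu_i)+\mathcal O(u^2),\qquad \mu_i\in\mathbb{R}^n,\ \|\mu_i\|_\infty\le u,$$ where $\operatorname{fl}(v_i^T\widehat y^{(i-1)})=v_i^T\widehat y^{(i-1)}+\varepsilon_i+\mathcal O(u^2)$. That is, the rounding error of the $i$-th inner product is identified, to first order, with $\varepsilon_i=\operatorname{fl}(v_i^Ty_C)$ (recall $v_i^Ty_C=0$ for $i\le k$), so that $|\varepsilon_i|\le\gamma_n\|y_C\|$. $\mathcal O(u^2)$ denotes terms bounded by a constant times $u^2$ as $u\to0$, with the constant depending only on the fixed data ($n$, $k$, $\theta$, $\lambda_i$, $v_i$, $y_C$). *)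

(* Defs.v *)
From HB Require Import structures.
From mathcomp Require Import all_boot all_order all_algebra.
From mathcomp Require Import all_classical all_reals all_analysis.

Set Implicit Arguments.
Unset Strict Implicit.
Unset Printing Implicit Defensive.

Import Order.TTheory GRing.Theory Num.Theory.
Import numFieldNormedType.Exports.
Local Open Scope ring_scope.

(* Indices are 0-based: [v i], [lam i] with [i : 'I_k] stand for v_{i+1} and
   lambda_{i+1}. *)

Section Definitions.
Variable R : realType.

Definition dot n (a b : 'cV[R]_n) : R := (a^T *m b) 0 0.

(* MathComp-Analysis' norm `|a| on matrices is the sup norm, hence this
   separate Euclidean norm; `|.| is used below where the sup norm is meant. *)
Definition norm2 n (a : 'cV[R]_n) : R := Num.sqrt (dot a a).

Definition orthonormal_family n m (v : 'I_m -> 'cV[R]_n) : Prop :=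
  forall i j, dot (v i) (v j) = (i == j)%:R.

Definition hadamard n (a b : 'cV[R]_n) : 'cV[R]_n := map2_mx *%R a b.

Definition alpha k (lam : 'I_k -> R) (theta : R) (i : 'I_k) : R :=
  1 - theta / lam i.

Definition slmp n k (v : 'I_k -> 'cV[R]_n) (lam : 'I_k -> R) (theta : R) :
    'M[R]_n :=
  \big[mulmx/1%:M]_(i < k) (1%:M - alpha lam theta i *: (v i *m (v i)^T)).

Definition gamma (n : nat) (u : R) : R := n%:R * u / (1 - n%:R * u).

(* [fl a b] is the computed value of the inner product of a and b. *)
Definition fl_dot_model n (u : R) (fl : 'cV[R]_n -> 'cV[R]_n -> R) : Prop :=
  forall a b, `|fl a b - dot a b| <= gamma n u * norm2 a * norm2 b.

(* [yhat i], 0 <= i <= k, are the successive computed vectors, [yhat k] being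
   fl(H_k yC). [K] is the constant of the O(u^2) terms [rho] and [r]; the
   first-order error of every inner product is eps_i = [fl (v i) yC]. *)
Definition fl_apply_model n k (K u : R) (fl : 'cV[R]_n -> 'cV[R]_n -> R)
    (v : 'I_k -> 'cV[R]_n) (lam : 'I_k -> R) (theta : R) (yC : 'cV[R]_n)
    (yhat : nat -> 'cV[R]_n) : Prop :=
  yhat 0%N = yC /\
  forall i : 'I_k,
    (exists rho : R, `|rho| <= K * u ^+ 2 /\
       fl (v i) (yhat i) = dot (v i) (yhat i) + fl (v i) yC + rho) /\
    (exists mu r : 'cV[R]_n, [/\ `|mu| <= u, norm2 r <= K * u ^+ 2 &
       yhat i.+1 =
         hadamard (yhat i - (alpha lam theta i * fl (v i) (yhat i)) *: v i)
                  (const_mx 1 + mu) + r]).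

Definition first_order_bound n k (u : R) (lam : 'I_k -> R) (theta : R) : R :=
  (gamma n u + k%:R * u) * Num.sqrt (\sum_(i < k) alpha lam theta i ^+ 2)
  + k%:R * u.

Definition theta_WAM k (lam : 'I_k -> R) : R :=
  (\sum_(i < k) (lam i)^-1) / (\sum_(i < k) (lam i ^+ 2)^-1).

Definition weighted_mean k (w x : 'I_k -> R) : R :=
  (\sum_(i < k) w i * x i) / (\sum_(i < k) w i).

End Definitions.

(* Main.v *)
Require Import Defs.
From HB Require Import structures.
From mathcomp Require Import all_boot all_order all_algebra.
From mathcomp Require Import all_classical all_reals all_analysis.
From mathcomp Require Import ring lra.

Set Implicit Arguments.
Unset Strict Implicit.
Unset Printing Implicit Defensive.

Import Order.TTheory GRing.Theory Num.Theory.
Import numFieldNormedType.Exports.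
Local Open Scope classical_set_scope.
Local Open Scope ring_scope.

(** Why the theorem holds. Write [e] for the error of the current computed
    vector and [A i] for [alpha lam theta i]. Since [v i] is orthogonal to [yC],
    a computed step replaces [e] by
      [e - A i (eps_i + <v i, e>) v i + mu_i o yC]
    plus terms of second order ([rounded_step]), where [|eps_i|] is at most
    [gamma n u |yC|] and [|mu_i o yC|] at most [u |yC|].

    By orthonormality, the factor of index [i] does not touch components along
    the other [v j]. Hence after [m] steps the error is, up to [O(u^2)], equal
    to [z - \sum_j A j a_j v j], where [z] is the sum of the vectors
    [mu_i o yC], of norm at most [m u |yC|], and where each
    [a_j = eps_j + <v j, z_j>] involves only the part [z_j] of [z] accumulated
    before step [j], so that [|a_j|] is at most [(gamma n u + k u) |yC|]
    ([error_split_step]). Pythagoras bounds the sum along the [v j] by this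
    common factor times [sqrt (\sum_j A j ^ 2)], and adding [k u |yC|] for [z]
    gives the first-order bound ([error_split_norm2]). The bound itself shows
    that errors are [O(u)], which is what makes the remainder of the next step
    [O(u^2)]; so both estimates are carried along the same induction
    ([error_split_computed]).

    As a function of [theta], the bound is an increasing function of
    [\sum_i (1 - theta / lam i) ^ 2], a quadratic polynomial with positive
    leading coefficient whose vertex is [theta_WAM] ([sum_sqr_alphaE]). *)

(** * Euclidean geometry of column vectors *)

Section Euclidean.
Variables (R : realType) (n : nat).
Implicit Types (a b c mu : 'cV[R]_n) (x : R).

Lemma dotE a b : dot a b = \sum_i a i 0 * b i 0.
Proof. by rewrite /dot mxE; apply: eq_bigr => i _; rewrite mxE. Qed.

Lemma dotC a b : dot a b = dot b a.
Proof. by rewrite !dotE; apply: eq_bigr => i _; rewrite mulrC. Qed.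

Lemma dotDr a b c : dot a (b + c) = dot a b + dot a c.
Proof. by rewrite /dot mulmxDr mxE. Qed.

Lemma dotNr a b : dot a (- b) = - dot a b.
Proof. by rewrite /dot mulmxN mxE. Qed.

Lemma dotZr a x b : dot a (x *: b) = x * dot a b.
Proof. by rewrite /dot -scalemxAr mxE. Qed.

Lemma dotDl a b c : dot (a + b) c = dot a c + dot b c.
Proof. by rewrite dotC dotDr !(dotC c). Qed.

Lemma dotNl a b : dot (- a) b = - dot a b.
Proof. by rewrite dotC dotNr (dotC b). Qed.

Lemma dotZl x a b : dot (x *: a) b = x * dot a b.
Proof. by rewrite dotC dotZr (dotC b). Qed.

Lemma dot_sumr (I : finType) a (F : I -> 'cV[R]_n) :
  dot a (\sum_i F i) = \sum_i dot a (F i).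
Proof. by rewrite /dot mulmx_sumr summxE. Qed.

Lemma dot_ge0 a : 0 <= dot a a.
Proof. by rewrite dotE sumr_ge0 // => i _; rewrite -expr2 sqr_ge0. Qed.

Lemma dot_eq0 a : (dot a a == 0) = (a == 0).
Proof.
apply/eqP/eqP => [|->]; last by rewrite /dot mulmx0 mxE.
rewrite dotE => /psumr_eq0P a0; apply/colP => i; rewrite mxE.
have /a0 /(_ i isT) /eqP : forall j, true -> 0 <= a j 0 * a j 0.
  by move=> j _; rewrite -expr2 sqr_ge0.
by rewrite mulf_eq0 orbb => /eqP.
Qed.

Lemma norm2_ge0 a : 0 <= norm2 a.
Proof. exact: sqrtr_ge0. Qed.

Lemma sqr_norm2 a : norm2 a ^+ 2 = dot a a.
Proof. by rewrite sqr_sqrtr ?dot_ge0. Qed.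

Lemma norm2_gt0 a : (0 < norm2 a) = (a != 0).
Proof. by rewrite sqrtr_gt0 lt_def dot_eq0 dot_ge0 andbT. Qed.

Lemma norm2_0 : norm2 (0 : 'cV[R]_n) = 0.
Proof. by rewrite /norm2 (eqP (_ : dot 0 0 == 0)) ?dot_eq0 // sqrtr0. Qed.

(** The vector [|b|^2 a - <a,b> b], which is [|b|^2] times the component of
    [a] orthogonal to [b], has nonnegative square norm. *)
Lemma cauchy_schwarz a b : `|dot a b| <= norm2 a * norm2 b.
Proof.
have [->|b0] := eqVneq b 0; first by rewrite norm2_0 mulr0 /dot mulmx0 mxE normr0.
have bb : 0 < dot b b by rewrite lt_def dot_eq0 b0 dot_ge0.
rewrite -ler_sqr ?nnegrE ?mulr_ge0 ?norm2_ge0 // exprMn !sqr_norm2.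
rewrite real_normK ?num_real //.
have := dot_ge0 (dot b b *: a - dot a b *: b).
rewrite !(dotDl, dotDr, dotNl, dotNr, dotZl, dotZr) (dotC b a) => h.
rewrite -subr_ge0 -(pmulr_rge0 _ bb); lra.
Qed.

Lemma norm2D a b : norm2 (a + b) <= norm2 a + norm2 b.
Proof.
rewrite -ler_sqr ?nnegrE ?addr_ge0 ?norm2_ge0 // sqrrD !sqr_norm2.
rewrite dotDl !dotDr (dotC b a).
by have := ler_normlW (cauchy_schwarz a b); lra.
Qed.

Lemma norm2N a : norm2 (- a) = norm2 a.
Proof. by rewrite /norm2 dotNl dotNr opprK. Qed.

Lemma norm2Z x a : norm2 (x *: a) = `|x| * norm2 a.
Proof.
by rewrite /norm2 dotZl dotZr mulrA -expr2 sqrtrM ?sqr_ge0 // sqrtr_sqr.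
Qed.

(** The rounding errors [mu] are bounded componentwise, in the sup norm; this is
    how they enter the Euclidean estimates. *)
Lemma norm2_hadamard a mu : norm2 (hadamard a mu) <= `|mu| * norm2 a.
Proof.
rewrite -ler_sqr ?nnegrE ?mulr_ge0 ?norm2_ge0 // exprMn !sqr_norm2 !dotE.
rewrite mulr_sumr ler_sum // => i _; rewrite !mxE -!expr2 exprMn mulrC.
rewrite ler_wpM2r ?sqr_ge0 // -[leLHS]real_normK ?num_real //.
rewrite ler_sqr ?nnegrE // [leRHS]/Num.norm /= mx_normrE.
exact: (le_bigmax _ (fun ij => `|mu ij.1 ij.2|) (i, 0)).
Qed.

Lemma hadamardDl a b mu : hadamard (a + b) mu = hadamard a mu + hadamard b mu.
Proof. by apply/colP => i; rewrite !mxE mulrDl. Qed.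

Lemma hadamard1D a mu : hadamard a (const_mx 1 + mu) = a + hadamard a mu.
Proof. by apply/colP => i; rewrite !mxE mulrDr mulr1. Qed.

Lemma dot_span_eq0 a (X : seq 'cV[R]_n) b :
  (forall c, c \in X -> dot a c = 0) -> b \in <<X>>%VS -> dot a b = 0.
Proof.
move=> aX /(@coord_span _ _ _ (in_tuple X)) ->; rewrite dot_sumr big1 // => i _.
by rewrite dotZr aX ?mulr0 // mem_nth.
Qed.

(** Pythagoras: dominating every coordinate by a common factor [g] dominates
    the whole combination by [g] times the norm of the coefficients. *)
Lemma norm2_orthonormal_sum k (w : 'I_k -> 'cV[R]_n) (c a : 'I_k -> R) g :
  orthonormal_family w -> 0 <= g -> (forall j, `|a j| <= g) ->
  norm2 (\sum_j (c j * a j) *: w j) <= g * Num.sqrt (\sum_j c j ^+ 2).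
Proof.
move=> w_on g0 ag; rewrite -[g in leRHS]ger0_norm // -sqrtr_sqr -sqrtrM ?sqr_ge0 //.
rewrite ler_wsqrtr // dot_sumr mulr_sumr ler_sum // => i _.
rewrite dotZr dotC dot_sumr (bigD1 i) //= big1 => [|j ji]; last first.
  by rewrite dotZr w_on eq_sym (negbTE ji) mulr0.
rewrite dotZr w_on eqxx mulr1 addr0 -expr2 exprMn mulrC ler_wpM2r ?sqr_ge0 //.
by rewrite -[leLHS]real_normK ?num_real // ler_sqr ?nnegrE.
Qed.

End Euclidean.

(** * The first-order error bound as a function of [theta] *)

Section FirstOrderBound.
Variables (R : realType) (n : nat).

Lemma gamma_ge0 (u : R) : 0 <= u -> n%:R * u < 1 -> 0 <= gamma n u.
Proof. by move=> u0 nu1; rewrite divr_ge0 ?mulr_ge0 ?ler0n // subr_ge0 ltW. Qed.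

Lemma gamma_le (u : R) : 0 <= u -> n%:R * u <= 2^-1 -> gamma n u <= 2 * n%:R * u.
Proof.
move=> u0 nu; rewrite ler_pdivrMr; last by lra.
have nu0 : 0 <= n%:R * u by rewrite mulr_ge0 ?ler0n.
by nra.
Qed.

(** Both first-order sources enter linearly: [2 n] bounds the slope of
    [gamma n] on the range where [n u <= 1/2]. *)
Lemma first_order_bound_le k (lam : 'I_k -> R) theta (u : R) :
  0 <= u -> n%:R * u <= 2^-1 ->
  first_order_bound n u lam theta <=
    ((2 * n%:R + k%:R) * Num.sqrt (\sum_(i < k) alpha lam theta i ^+ 2) + k%:R) * u.
Proof.
move=> u0 nu; rewrite /first_order_bound; set S := Num.sqrt _.
have S0 : 0 <= S by exact: sqrtr_ge0.
have g := gamma_le u0 nu.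
by nra.
Qed.

Lemma sqr_alpha_le k (lam : 'I_k -> R) theta (i : 'I_k) :
  `|alpha lam theta i| <= Num.sqrt (\sum_(j < k) alpha lam theta j ^+ 2).
Proof.
rewrite -sqrtr_sqr ler_wsqrtr // (bigD1 i) //= lerDl sumr_ge0 // => j _.
exact: sqr_ge0.
Qed.

Variables (k : nat) (lam : 'I_k -> R).
Hypotheses (k_gt0 : (0 < k)%N) (lam_gt0 : forall i, 0 < lam i).

Lemma sum_inv_gt0 (f : 'I_k -> R) : (forall i, 0 < f i) -> 0 < \sum_i (f i)^-1.
Proof.
move=> f0; rewrite (bigD1 (Ordinal k_gt0)) //= ltr_wpDr ?invr_gt0 //.
by rewrite sumr_ge0 // => i _; rewrite invr_ge0 ltW.
Qed.

Lemma theta_WAM_gt0 : 0 < theta_WAM lam.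
Proof. by rewrite divr_gt0 // sum_inv_gt0 // => i; rewrite exprn_gt0. Qed.

(** The sum of the [(1 - theta / lam i)^2] is a quadratic polynomial in
    [theta] with leading coefficient [\sum_i 1 / lam i ^2], and [theta_WAM] is
    its vertex. *)
Lemma sum_sqr_alphaE theta :
  \sum_i alpha lam theta i ^+ 2 =
  \sum_i alpha lam (theta_WAM lam) i ^+ 2 +
  (\sum_i (lam i ^+ 2)^-1) * (theta - theta_WAM lam) ^+ 2.
Proof.
have E t : \sum_i alpha lam t i ^+ 2 =
    k%:R - 2 * t * (\sum_i (lam i)^-1) + t ^+ 2 * \sum_i (lam i ^+ 2)^-1.
  rewrite !mulr_sumr -[k in k%:R]card_ord -sum1_card natr_sum -sumrB -big_split /=.
  by apply: eq_bigr => i _; rewrite /alpha -exprVn; ring.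
rewrite !E; set t := theta_WAM lam.
have S2 : 0 < \sum_i (lam i ^+ 2)^-1 by apply: sum_inv_gt0 => i; rewrite exprn_gt0.
have -> : \sum_i (lam i)^-1 = t * \sum_i (lam i ^+ 2)^-1.
  by rewrite /t /theta_WAM divfK // gt_eqF.
by ring.
Qed.

Lemma first_order_bound_min (u theta : R) :
  0 < u -> n%:R * u < 1 -> theta != theta_WAM lam ->
  first_order_bound n u lam (theta_WAM lam) < first_order_bound n u lam theta.
Proof.
move=> u0 nu ne; rewrite ltrD2r ltr_pM2l; last first.
  by rewrite ltr_wpDl ?gamma_ge0 ?mulr_gt0 ?ltr0n // ltW.
have pos : 0 < (\sum_i (lam i ^+ 2)^-1) * (theta - theta_WAM lam) ^+ 2.
  rewrite mulr_gt0 ?exprn_even_gt0 ?subr_eq0 //.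
  by apply: sum_inv_gt0 => i; rewrite exprn_gt0.
rewrite [X in _ < Num.sqrt X]sum_sqr_alphaE ltr_sqrt ?ltrDl //.
by rewrite ltr_wpDl // sumr_ge0 // => i _; exact: sqr_ge0.
Qed.

Lemma theta_WAM_weighted_mean :
  theta_WAM lam = weighted_mean (fun i => 1 / lam i ^+ 2) lam.
Proof.
congr (_ / _); apply: eq_bigr => i _; rewrite mul1r //.
by rewrite expr2 invfM mulfVK // gt_eqF.
Qed.

End FirstOrderBound.

(** * Propagation of rounding errors through the rank-one factors *)

Section RoundingErrors.
Variables (R : realType) (n k : nat) (w : 'I_k -> 'cV[R]_n).
Variables (lam : 'I_k -> R) (theta : R) (y : 'cV[R]_n).
Hypothesis w_on : orthonormal_family w.
Hypothesis wy0 : forall i, dot (w i) y = 0.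

Let A := alpha lam theta.
Let S := Num.sqrt (\sum_(j < k) A j ^+ 2).
Let N := norm2 y.

Let S_ge0 : 0 <= S. Proof. exact: sqrtr_ge0. Qed.
Let N_ge0 : 0 <= N. Proof. exact: norm2_ge0. Qed.
Let A_le i : `|A i| <= S. Proof. exact: sqr_alpha_le. Qed.

Lemma slmp_fixes : slmp w lam theta *m y = y.
Proof.
rewrite /slmp; elim/big_ind: _ => [|M M' My M'y|i _].
- by rewrite mul1mx.
- by rewrite -mulmxA M'y.
rewrite mulmxBl mul1mx -scalemxAl -mulmxA (_ : (w i)^T *m y = 0).
  by rewrite mulmx0 scaler0 subr0.
by apply/matrixP => a b; rewrite !ord1 [RHS]mxE; exact: wy0.
Qed.

Lemma norm2_orthonormal i : norm2 (w i) = 1.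
Proof. by rewrite /norm2 w_on eqxx sqrtr1. Qed.

Lemma dot_orthonormal_le i a : `|dot (w i) a| <= norm2 a.
Proof. by rewrite (le_trans (cauchy_schwarz _ _)) // norm2_orthonormal mul1r. Qed.

Lemma norm2_scale_orthonormal i x b :
  `|x| <= b -> norm2 (- (A i * x) *: w i) <= S * b.
Proof.
by move=> xb; rewrite norm2Z norm2_orthonormal mulr1 normrN normrM ler_pM.
Qed.

(** Exactly, one computed step acts on the error [e] as the rank-one factor
    does, except for the inner product error [eps], the rounding
    [hadamard y mu] of the unperturbed vector, and a remainder [s] made of the
    second-order terms [rho] and [r] of the model and of the product of [mu]
    with the perturbation of [y]. *)
Lemma rounded_step (K u : R) (i : 'I_k) (e mu r : 'cV[R]_n) (eps rho : R) :
  0 <= u -> `|rho| <= K * u ^+ 2 -> `|mu| <= u -> norm2 r <= K * u ^+ 2 ->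
  exists2 s,
    hadamard (y + e - (A i * (dot (w i) (y + e) + eps + rho)) *: w i)
        (const_mx 1 + mu) + r - y =
      e - (A i * (eps + dot (w i) e)) *: w i + hadamard y mu + s &
    norm2 s <= u * (norm2 e + S * (norm2 e + `|eps| + K * u ^+ 2))
               + (S + 1) * (K * u ^+ 2).
Proof.
move=> u0 rhoK muu rK; set x := dot (w i) e + eps + rho.
exists (hadamard (e + - (A i * x) *: w i) mu + - (A i * rho) *: w i + r).
  rewrite dotDr wy0 add0r -/x hadamard1D.
  have -> : y + e - (A i * x) *: w i = y + (e + - (A i * x) *: w i).
    by rewrite scaleNr addrA.
  rewrite hadamardDl; apply/colP => j; rewrite !mxE /x; ring.
rewrite (le_trans (norm2D _ _)) // (mulrDl S) mul1r addrA lerD //.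
rewrite (le_trans (norm2D _ _)) // lerD ?norm2_scale_orthonormal //.
rewrite (le_trans (norm2_hadamard _ _)) // ler_pM ?norm2_ge0 //.
rewrite (le_trans (norm2D _ _)) // lerD2l norm2_scale_orthonormal //.
rewrite (le_trans (ler_normD _ _)) // lerD // (le_trans (ler_normD _ _)) //.
by rewrite lerD // dot_orthonormal_le.
Qed.

(** The shape of the error after [m] steps: [z] collects the rounding errors of
    the vector updates, the [a j] are the total errors of the coefficients
    along the [w j] already processed, and [s] is of second order. Keeping the
    [w j] components apart from [z] is what yields the Euclidean norm of the
    [alpha]'s in the bound, instead of the sum of their absolute values. *)
Definition error_split (u D : R) (m : nat) (e : 'cV[R]_n) : Prop :=
  exists (a : 'I_k -> R) (z s : 'cV[R]_n),
  [/\ e = z - \sum_j (A j * a j) *: w j + s,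
      forall j : 'I_k, (m <= j)%N -> a j = 0,
      forall j, `|a j| <= (gamma n u + k%:R * u) * N,
      norm2 z <= m%:R * u * N & norm2 s <= D * u ^+ 2].

Lemma error_split_norm2 (u D : R) (m : nat) (e : 'cV[R]_n) :
  0 <= u -> n%:R * u < 1 -> (m <= k)%N -> error_split u D m e ->
  norm2 e <= first_order_bound n u lam theta * N + D * u ^+ 2.
Proof.
move=> u0 nu mk [a [z [s [-> _ aG zm sD]]]].
have G0 : 0 <= (gamma n u + k%:R * u) * N.
  by rewrite mulr_ge0 // addr_ge0 ?gamma_ge0 // mulr_ge0.
rewrite (le_trans (norm2D _ _)) // lerD // (le_trans (norm2D _ _)) // norm2N.
rewrite /first_order_bound [leRHS]mulrDl addrC lerD //.
  by rewrite mulrAC norm2_orthonormal_sum.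
by rewrite (le_trans zm) // ler_wpM2r // ler_wpM2r // ler_nat.
Qed.

(** The factor of index [m] leaves the components along the earlier [w j]
    untouched, by orthogonality; so the coefficient error that it creates is
    the inner product error [eps] plus only what it picks up from [z] and,
    in second order, from [s]. *)
Lemma error_split_step (u D T : R) (i : 'I_k) (e mu s : 'cV[R]_n) (eps : R) :
  0 <= u -> `|mu| <= u -> `|eps| <= gamma n u * N -> norm2 s <= T * u ^+ 2 ->
  error_split u D i e ->
  error_split u ((1 + S) * D + T) i.+1
    (e - (A i * (eps + dot (w i) e)) *: w i + hadamard y mu + s).
Proof.
move=> u0 muu epsg sT [a [z [s' [eE a0 aG zi sD]]]].
have wie : dot (w i) e = dot (w i) z + dot (w i) s'.
  rewrite eE !dotDr dotNr dot_sumr big1 ?subr0 // => j _; rewrite dotZr w_on.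
  by have [<-|_] := eqVneq i j; rewrite ?mulr0 // a0 ?mulr0 ?mul0r.
(* The coefficient of [w i] was still 0, so setting it leaves the others as
   they are. *)
pose a' j := if j == i then eps + dot (w i) z else a j.
exists a', (z + hadamard y mu), (s' + - (A i * dot (w i) s') *: w i + s); split.
- have -> : \sum_j (A j * a' j) *: w j =
            \sum_j (A j * a j) *: w j + (A i * (eps + dot (w i) z)) *: w i.
    rewrite (bigD1 i) //= [in RHS](bigD1 i) //= /a' eqxx a0 // mulr0 scale0r add0r.
    by rewrite addrC; congr (_ + _); apply: eq_bigr => j /negbTE ->.
  rewrite wie eE; move: (\sum_j _) => c.
  by apply/colP => j; rewrite !mxE; ring.
- move=> j ij; rewrite /a' a0 ?(ltnW ij) //.
  by case: eqP => // ji; rewrite ji ltnn in ij.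
- move=> j; rewrite /a'; case: ifP => // _; rewrite mulrDl.
  rewrite (le_trans (ler_normD _ _)) // lerD //.
  rewrite (le_trans (dot_orthonormal_le _ _)) // (le_trans zi) //.
  by rewrite ler_wpM2r // ler_wpM2r // ler_nat ltnW.
- rewrite (le_trans (norm2D _ _)) // -addn1 natrD !mulrDl mul1r lerD //.
  by rewrite (le_trans (norm2_hadamard _ _)) // ler_wpM2r.
rewrite (le_trans (norm2D _ _)) // (mulrDl _ T) lerD //.
rewrite (le_trans (norm2D _ _)) // (mulrDl 1 S) mul1r (mulrDl D) lerD //.
rewrite -mulrA norm2_scale_orthonormal //.
exact: le_trans (dot_orthonormal_le _ _) sD.
Qed.

(** Induction on the number [m] of factors applied. By the split, the error
    entering a step is [O(u)], so the remainder of the step is [O(u^2)], with a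
    constant built from the fixed data only. *)
Lemma error_split_computed (K : R) (m : nat) : 0 <= K -> (m <= k)%N ->
  exists2 D, 0 <= D & forall (u : R) fl yhat,
    0 <= u -> n.+1%:R * u <= 2^-1 -> fl_dot_model u fl ->
    fl_apply_model K u fl w lam theta y yhat ->
    error_split u D m (yhat m - y).
Proof.
move=> K0; elim: m => [_|m IH mk].
  exists 0 => // u fl yhat u0 nu _ [-> _].
  exists (fun=> 0), 0, 0; split=> //.
  - by rewrite subrr addr0 big1 ?subr0 // => j _; rewrite mulr0 scale0r.
  - have nu1 : n%:R * u < 1 by move: nu; rewrite -natr1; lra.
    by move=> j; rewrite normr0 mulr_ge0 // addr_ge0 ?gamma_ge0 // mulr_ge0.
  - by rewrite norm2_0 !mul0r.
  - by rewrite norm2_0 mul0r.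
have [D D0 {}IH] := IH (ltnW mk); pose i := Ordinal mk.
pose F := (2 * n%:R + k%:R) * S + k%:R.
have F0 : 0 <= F by rewrite addr_ge0 // mulr_ge0 // addr_ge0 // mulr_ge0.
pose E := F * N + D.
have E0 : 0 <= E by rewrite addr_ge0 // mulr_ge0.
pose T := E + S * (E + 2 * n%:R * N + K) + (S + 1) * K.
have T0 : 0 <= T.
  by rewrite /T !(addr_ge0, mulr_ge0).
exists ((1 + S) * D + T) => [|u fl yhat u0 nu hfl hyhat].
  by rewrite addr_ge0 // mulr_ge0 // addr_ge0.
have n0 : 0 <= n%:R * u by rewrite mulr_ge0.
(* The single hypothesis on [u] controls both [u] and [n u], even for
   [n = 0]. *)
have [u1 nu2] : u <= 2^-1 /\ n%:R * u <= 2^-1.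
  by move: nu; rewrite -natr1; split; lra.
have uu : u ^+ 2 <= u by rewrite expr2; nra.
have split_m := IH _ _ _ u0 nu hfl hyhat.
have [_ /(_ i) [[rho [rhoK flE]] [mu [r [muu rK yE]]]]] := hyhat.
have epsg : `|fl (w i) y| <= gamma n u * N.
  have := hfl (w i) y; rewrite wy0 subr0 norm2_orthonormal mulr1; exact.
move: flE yE; rewrite /= -[yhat m](subrKC y); set e := yhat m - y in split_m *.
move=> -> ->.
have [s -> sle] := rounded_step i e (fl (w i) y) u0 rhoK muu rK.
apply: error_split_step => //; apply: le_trans sle _.
have eE : norm2 e <= E * u.
  apply: le_trans (error_split_norm2 u0 _ (ltnW mk) split_m) _; first by lra.
  rewrite (mulrDl (F * N)) lerD ?ler_wpM2l // mulrAC ler_wpM2r //.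
  exact: first_order_bound_le.
have epsE : `|fl (w i) y| <= 2 * n%:R * N * u.
  by rewrite (le_trans epsg) // (mulrAC _ N) ler_wpM2r // gamma_le.
have KE : K * u ^+ 2 <= K * u by rewrite ler_wpM2l.
have inner : norm2 e + S * (norm2 e + `|fl (w i) y| + K * u ^+ 2) <=
             (E + S * (E + 2 * n%:R * N + K)) * u.
  rewrite (mulrDl E) lerD // -mulrA ler_wpM2l // (mulrDl _ K) (mulrDl E).
  by rewrite lerD // lerD.
have := ler_wpM2l u0 inner; rewrite /T; lra.
Qed.

Lemma computed_error_le (K : R) : y != 0 ->
  exists C, forall (u : R) fl yhat,
    0 <= u -> n.+1%:R * u <= 2^-1 -> fl_dot_model u fl ->
    fl_apply_model K u fl w lam theta y yhat ->
    norm2 (y - yhat k) / norm2 y <=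
      first_order_bound n u lam theta + C * u ^+ 2.
Proof.
move=> y0; have N0 : 0 < N by rewrite /N norm2_gt0.
(* A negative [K] is replaced by its absolute value, to keep constants
   nonnegative. *)
have [D D0 hD] := @error_split_computed `|K| k (normr_ge0 K) (leqnn k).
exists (D / N) => u fl yhat u0 nu hfl [yhat0 hstep].
have wK x : x <= K * u ^+ 2 -> x <= `|K| * u ^+ 2.
  by move=> /le_trans; apply; rewrite ler_wpM2r ?sqr_ge0 // ler_norm.
have hyhat : fl_apply_model `|K| u fl w lam theta y yhat.
  split=> // i; have [[rho [/wK rhoK flE]] [mu [r [muu /wK rK yE]]]] := hstep i.
  by split; [exists rho | exists mu, r].
have nu1 : n%:R * u < 1 by move: nu; rewrite -natr1; lra.
have := error_split_norm2 u0 nu1 (leqnn k) (hD _ _ _ u0 nu hfl hyhat).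
rewrite -norm2N opprB => le_e; rewrite ler_pdivrMr //.
by rewrite (mulrDl _ (D / N * u ^+ 2)) [X in _ <= _ + X]mulrAC divfK ?gt_eqF.
Qed.

End RoundingErrors.

(** * The error bound and its minimizer *)

Theorem theorem3p3 (R : realType) (n k : nat) (k_gt0 : (0 < k)%N)
    (le_kn : (k <= n)%N) (v : 'I_n -> 'cV[R]_n) (v_on : orthonormal_family v)
    (lam : 'I_k -> R) (lam_gt0 : forall i, 0 < lam i)
    (lam_noninc : forall i j : 'I_k, (i <= j)%N -> lam j <= lam i) :
  let vk := fun i : 'I_k => v (widen_ord le_kn i) in
  (forall (theta : R) (yC : 'cV[R]_n), 0 < theta ->
     yC \in <<[seq v i | i : 'I_n <- enum 'I_n & (k <= i)%N]>>%VS -> yC != 0 ->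
     slmp vk lam theta *m yC = yC /\
     forall K : R, exists C : R, \forall u \near 0^'+,
       n%:R * u < 1 ->
       forall (fl : 'cV[R]_n -> 'cV[R]_n -> R) (yhat : nat -> 'cV[R]_n),
         fl_dot_model u fl ->
         fl_apply_model K u fl vk lam theta yC yhat ->
         norm2 (yC - yhat k) / norm2 yC <=
           first_order_bound n u lam theta + C * u ^+ 2) /\
  (forall u : R, 0 < u -> n%:R * u < 1 ->
     0 < theta_WAM lam /\
     forall theta : R, theta != theta_WAM lam ->
       first_order_bound n u lam (theta_WAM lam) <
         first_order_bound n u lam theta) /\
  theta_WAM lam = weighted_mean (fun i => 1 / lam i ^+ 2) lam.
Proof.
have w_on : orthonormal_family (fun i => v (widen_ord le_kn i)).
  by move=> i j; rewrite v_on.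
move=> vk; split; [|split].
- move=> theta yC _ yC_span yC0.
  have wy0 i : dot (vk i) yC = 0.
    apply: dot_span_eq0 yC_span => c /mapP[j].
    rewrite mem_filter => /andP[kj _] ->; rewrite v_on.
    by case: eqP => // ij; move: kj; rewrite -ij leqNgt /= ltn_ord.
  split; first exact: slmp_fixes.
  move=> K; have [C hC] := computed_error_le lam theta w_on wy0 K yC0.
  exists C; near=> u => _ fl yhat; apply: hC.
    by near: u; exact: nbhs_right_ge.
  rewrite -ler_pdivlMl ?ltr0n //; near: u; apply: nbhs_right_le.
  by rewrite mulr_gt0 ?invr_gt0 ?ltr0n.
- move=> u u0 nu; split; first exact: theta_WAM_gt0.
  by move=> theta; exact: first_order_bound_min.
- exact: theta_WAM_weighted_mean.
Unshelve. all: by end_near.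
Qed.
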